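(* For every $\xi>0$ there exists $\Delta_0$ such that for all $\Delta\ge\Delta_0$: if $G$ is a triangle-free graph of maximum degree at most $\Delta$ with correspondence-assignment $(L,M)$ such that for each $v\in V(G)$, \[ |L(v)|\ge(4+\xi)\frac{\deg(v)}{\log_2(\deg(v))} \] and $\deg(v)\ge\ln^2(\Delta)$, then $G$ is $(L,M)$-colorable.
   Context: $\deg(v)$ is the degree of $v$. A correspondence-assignment $(L,M)$ for $G$ consists of a set $L(v)$ of colors for each vertex $v$, and for each edge $e=uv$ a matching $M_e$ between $\{u\}\times L(u)$ and $\{v\}\times L(v)$. An $(L,M)$-coloring is a map $\varphi$ with $\varphi(u)\in L(u)$ for all $u$ such that for every edge $e=uv$, $(u,\varphi(u))(v,\varphi(v))\notin M_e$. $G$ is $(L,M)$-colorable if such a coloring exists. *)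

(* Defs.v *)
From HB Require Import structures.
From mathcomp Require Import all_boot all_order all_algebra.
From mathcomp Require Import reals exp.

Set Implicit Arguments.
Unset Strict Implicit.
Unset Printing Implicit Defensive.

Import Order.TTheory GRing.Theory Num.Theory.

Definition simple_graph (V : finType) (E : rel V) : Prop :=
  symmetric E /\ irreflexive E.

Definition degree (V : finType) (E : rel V) (v : V) : nat :=
  #|[set u | E v u]|.

Definition max_degree (V : finType) (E : rel V) : nat :=
  \max_(v : V) degree E v.

Definition triangle_free (V : finType) (E : rel V) : Prop :=
  forall x y z : V, ~~ [&& E x y, E y z & E x z].

(* Edges of the complete bipartite graph between A and B are unordered pairs
   [set a; b]; a matching is a set of pairwise disjoint such edges. *)
Definition matching_between (T : finType) (A B : {set T})
    (M : {set {set T}}) : Prop :=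
  (forall f : {set T}, f \in M ->
     exists a b : T, [/\ a \in A, b \in B & f = [set a; b]]) /\
  (forall f g : {set T}, f \in M -> g \in M -> f != g -> [disjoint f & g]).

(* M is indexed by the unordered pair of endpoints of an edge; its values on
   sets that are not edges are irrelevant. *)
Definition correspondence_assignment (V : finType) (E : rel V) (C : finType)
    (L : V -> {set C}) (M : {set V} -> {set {set V * C}}) : Prop :=
  forall u v : V, E u v ->
    matching_between (setX [set u] (L u)) (setX [set v] (L v)) (M [set u; v]).

Definition LM_coloring (V : finType) (E : rel V) (C : finType)
    (L : V -> {set C}) (M : {set V} -> {set {set V * C}})
    (phi : V -> C) : Prop :=
  (forall u : V, phi u \in L u) /\
  (forall u v : V, E u v -> [set (u, phi u); (v, phi v)] \notin M [set u; v]).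

Definition LM_colorable (V : finType) (E : rel V) (C : finType)
    (L : V -> {set C}) (M : {set V} -> {set {set V * C}}) : Prop :=
  exists phi : V -> C, LM_coloring E L M phi.

Definition log2 (R : realType) (x : R) : R := (ln x / ln 2%:R)%R.

(* Main.v *)
(* Colorings are counted by induction on the vertex set (Rosenfeld's method).
   Claim: for l = 48 ln Delta, adding a vertex v to a set S multiplies the number
   of colorings of the induced subgraph by at least l, i.e. a uniformly random
   coloring of S leaves at least l colors available at v on average.

   By the induction hypothesis for S minus u, a neighbor u of v has at most 8
   available colors (is "bad") with probability at most 8 / l, so on average v has
   at most 8 deg(v) / l bad neighbors, each blocking at most one color of v. Since
   the neighborhood of v is independent, conditionally on the rest of the coloring
   the colors of the neighbors are independent and uniform in their available
   lists. A color x of v not blocked by a bad neighbor therefore survives with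
   probability at least exp (- K x), where the sum of the K x over L(v) is at most
   9/8 deg(v). Bounding exp (- K x) below by its tangent line at
   m = 9/20 ln deg(v) makes all averages linear, and yields at least
   5/2 deg(v)^(11/20) / ln deg(v) >= 48 sqrt(deg(v)) >= l available colors. *)

Require Import Defs.
From HB Require Import structures.
From mathcomp Require Import all_boot all_order all_algebra.
From mathcomp Require Import reals sequences exp.
From mathcomp Require Import ring lra.

Set Implicit Arguments.
Unset Strict Implicit.
Unset Printing Implicit Defensive.

Import Order.TTheory GRing.Theory Num.Theory.
Local Open Scope ring_scope.

(** * Numerical estimates *)

Lemma ln2_ge (R : realType) : 2 / 3 <= ln (2 : R).
Proof.
rewrite -[leLHS]expRK ler_ln ?posrE ?expR_gt0 //.
(* The tenth power of this bound suffices because [(14/15) ^+ 10] still exceeds 1/2. *)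
have h : 14/15 <= expR (- (1/15)) :> R by apply: le_trans (expR_ge1Dx _); lra.
have e : expR (- (2/3)) = expR (- (1/15)) ^+ 10 :> R.
  by rewrite -expRM_natl; congr expR; lra.
have : (14/15) ^+ 10 <= expR (- (2/3)) :> R.
  by rewrite e lerXn2r // nnegrE ?expR_ge0 //; lra.
rewrite expRN => h2; rewrite -[leRHS]invrK -lef_pV2 ?posrE ?invr_gt0 ?expR_gt0 //.
  by rewrite invrK; apply: le_trans h2; lra.
Qed.

(** Here [D] stands for the logarithm of the degree bound, [d] for a degree and [q] for a list size;
    the tangent point is [9 / 20 * ln d]. *)
Lemma tangent_bound_ge (R : realType) (D d q : R) :
  expR (20 * 1000) <= D -> D ^+ 2 <= d -> ln d <= D -> 8 / 3 * (d / ln d) <= q ->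
  48 * D <=
  expR (- (9 / 20 * ln d)) * ((q - 8 * d / (48 * D)) * (1 + 9 / 20 * ln d) - 9 / 8 * d).
Proof.
move=> D0 Dd ld qd; have Dp : 0 < D by apply: lt_le_trans D0; rewrite expR_gt0.
have dp : 0 < d by apply: lt_le_trans Dd; rewrite exprn_gt0.
have y0 : 40 * 1000 <= ln d.
  rewrite -[leLHS]expRK ler_ln ?posrE ?expR_gt0 //; apply: le_trans Dd.
  have -> : expR (40 * 1000) = expR (20 * 1000) ^+ 2 :> R by rewrite -expRM_natl; congr expR; lra.
  by rewrite ler_pXn2r ?nnegrE ?expR_ge0 // ltW.
set y := ln d in ld qd y0 *.
have yp : 0 < y by lra.
have h1 : 8 * d / (48 * D) <= 1 / 6 * (d / y).
  have -> : 8 * d / (48 * D) = 1 / 6 * (d / D) by field; rewrite gt_eqF.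
  by rewrite ler_pM2l; [rewrite ler_pM2l // lef_pV2 | lra].
have h2 : 5 / 2 * (d / y) <=
    (q - 8 * d / (48 * D)) * (1 + 9 / 20 * y) - 9 / 8 * d.
  have h3 : 5 / 2 * (d / y) <= q - 8 * d / (48 * D) by lra.
  (* The tangent point is chosen so that [5/2 * 9/20 = 9/8]: the terms linear in [d] cancel
     exactly. *)
  have -> : 5 / 2 * (d / y) = (5 / 2 * (d / y)) * (1 + 9 / 20 * y) - 9 / 8 * d.
    by field; rewrite gt_eqF.
  by rewrite lerD2r ler_pM2r //; lra.
apply: le_trans (_ : expR (- (9 / 20 * y)) * (5 / 2 * (d / y)) <= _); last first.
  by rewrite ler_pM2l ?expR_gt0.
have dE : d = expR y by rewrite /y lnK.
have sD : D <= expR (y / 2).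
  rewrite -(@ler_pXn2r _ 2) ?nnegrE ?expR_ge0 ?(ltW Dp) //.
  apply: le_trans Dd _; rewrite -expRM_natl dE ler_expR; lra.
(* Of the three factors of [d = expR y], the one with exponent [9/20 * y] cancels, [expR (y / 2)]
   dominates [D], and [expR (y / 20) / y] absorbs the constant 48. *)
have -> : expR (- (9 / 20 * y)) * (5 / 2 * (d / y)) =
   expR (y / 2) * (5 / 2 * (expR (y / 20) / y)).
  have -> : d = expR (9 / 20 * y) * expR (y / 2) * expR (y / 20).
    by rewrite -!expRD dE; congr expR; field.
  by rewrite expRN; field; rewrite !gt_eqF // expR_gt0.
rewrite mulrC; apply: ler_pM; rewrite ?(ltW Dp) //.
have h4 : 1 + (y / 20) ^+ 2 / 2 <= expR (y / 20).
  by apply: (@expR_ge1Dxn R (y / 20) 1); lra.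
have : y / 800 <= expR (y / 20) / y.
  by rewrite ler_pdivlMr //; apply: le_trans h4; rewrite expr_div_n; lra.
by lra.
Qed.

(** * Double counting and convexity *)

Lemma sum_card_exchange (I J : finType) (A : {pred I}) (B : {pred J})
    (P : I -> J -> bool) :
  (\sum_(i in A) #|[set j in B | P i j]| =
   \sum_(j in B) #|[set i in A | P i j]|)%N.
Proof.
transitivity (\sum_(i in A) \sum_(j in B | P i j) 1)%N.
  by apply: eq_bigr => i _; rewrite sum1dep_card.
rewrite (exchange_big_dep (mem B)) /=; last by move=> i j _ /andP[].
apply: eq_bigr => j jB; rewrite -sum1dep_card; apply: eq_bigl => i.
by rewrite jB.
Qed.

Lemma card_family_prod (V C : finType) (A : V -> {set C}) :
  #|family A| = (\prod_u #|A u|)%N.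
Proof. by rewrite card_family foldrE big_map big_enum. Qed.

(** By convexity the tangent at [m] lies below the graph; being affine in [K], it can be summed over
    colors. *)
Lemma expR_tangent (R : realType) (m K : R) :
  expR (- m) * (1 + m - K) <= expR (- K).
Proof.
have -> : expR (- K) = expR (- m) * expR (m - K) by rewrite -expRD; congr expR; ring.
rewrite ler_pM2l ?expR_gt0 //.
by rewrite -addrA expR_ge1Dx.
Qed.

(** * Independent choices of colors around one vertex *)

Section LocalCount.
Variables (R : realType) (V C : finType) (b : V -> C -> C -> bool).

(** [b u y x] reads: color [y] on [u] forbids color [x] at the vertex to be added. *)
Definition unblocked (D : {set V}) (h : {ffun V -> C}) (x : C) :=
  [forall u in D, ~~ b u (h u) x].

Lemma card_unblocked (A : V -> {set C}) (D : {set V}) (x : C) :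
  #|[set h in family A | unblocked D h x]| =
  (\prod_u #|if u \in D then [set y in A u | ~~ b u y x] else A u|)%N.
Proof.
rewrite -card_family_prod; apply: eq_card => h; rewrite inE.
apply/andP/familyP => [[/familyP hA /forall_inP hD] u|hF].
  by case: ifP => uD //; rewrite inE hA hD.
split; first by apply/familyP => u; have := hF u; case: ifP; rewrite // inE => _ /andP[].
by apply/forall_inP => u uD; have := hF u; rewrite uD inE => /andP[].
Qed.

Variables (N : {set V}) (L : {set C}) (A : V -> {set C}).
Hypothesis b_injl : forall u y y' x, u \in N -> b u y x -> b u y' x -> y = y'.
Hypothesis b_injr : forall u y x x', u \in N -> b u y x -> b u y x' -> x = x'.

Let bad := [set u in N | (#|A u| <= 8)%N].
(** For a list of size [a >= 9] that can block [x], [k] is [1 / (a - 1)], so that [expR (- k)] is at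
    most [1 - 1 / a], the proportion of colors that spare [x]. *)
Let k (x : C) (u : V) : R := #|[set y in A u | b u y x]|%:R / (#|A u|%:R - 1).

(** Sending each blocked color to a vertex of [D] that blocks it is injective, by [b_injr]. *)
Lemma card_blocked_colors (D : {set V}) (h : {ffun V -> C}) : D \subset N ->
  (#|L| <= #|[set x in L | unblocked D h x]| + #|D|)%N.
Proof.
move=> /subsetP DN.
rewrite -(cardsID [set x | unblocked D h x] L) leq_add //.
  by apply: subset_leq_card; apply/subsetP => x; rewrite !inE.
pose w (x : C) := [pick u in D | b u (h u) x].
have wP x : x \in L :\: [set x | unblocked D h x] ->
    exists u, [/\ w x = Some u, u \in D & b u (h u) x].
  rewrite !inE => /andP[/forall_inPn [u uD /negbNE ub] _].
  rewrite /w; case: pickP => [u' /andP[]|/(_ u)]; first by exists u'.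
  by rewrite uD ub.
have winj : {in L :\: [set x | unblocked D h x] &, injective w}.
  move=> x x' /wP[u [-> uD ub]] /wP[u' [-> _ ub']] [uu'].
  by move: ub'; rewrite -uu' => ub'; apply: b_injr (DN _ uD) ub ub'.
rewrite -(card_in_imset winj) -(card_imset D (@Some_inj _)).
apply: subset_leq_card; apply/subsetP => _ /imsetP[x /wP[u [-> uD _]] ->].
by apply: imset_f.
Qed.

(** Both counts are products over the vertices, so they are compared factor by factor; only good
    neighbors change a factor. *)
Lemma unblocked_good_ge (x : C) :
  expR (- \sum_(u in N :\: bad) k x u) *
    #|[set h in family A | unblocked bad h x]|%:R
  <= #|[set h in family A | unblocked N h x]|%:R.
Proof.
rewrite !card_unblocked -sumrN expR_sum big_mkcond /= !natr_prod -big_split /=.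
apply: ler_prod => u _; rewrite mulr_ge0 //=; last by case: ifP; rewrite ?expR_ge0.
rewrite in_setD; have [ub|ub] /= := boolP (u \in bad).
  by rewrite mul1r; move: ub; rewrite inE => /andP[->].
case: ifP => [uN|_]; last by rewrite mul1r.
move: ub; rewrite inE uN /= -ltnNge => A9.
have A9R : 9 <= #|A u|%:R :> R by rewrite ler_nat.
have -> : [set y in A u | ~~ b u y x] = A u :\: [set y in A u | b u y x].
  by apply/setP => y; rewrite !inE; case: (y \in A u); rewrite ?andbT ?andbF.
have sub : [set y in A u | b u y x] \subset A u.
  by apply/subsetP => y; rewrite inE => /andP[].
rewrite cardsDS // natrB ?subset_leq_card // /k.
have : (#|[set y in A u | b u y x]| <= 1)%N.
  by apply/card_le1_eqP => y y'; rewrite !inE => /andP[_ h] /andP[_ h']; apply: b_injl uN h' h.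
case: #|[set y in A u | b u y x]| => [|[|//]] _.
  by rewrite mulr0n mul0r oppr0 expR0 mul1r addr0.
rewrite div1r expRN ler_pdivrMl ?expR_gt0 //.
have h := expR_ge1Dx (#|A u|%:R - 1 : R)^-1.
apply: le_trans (_ : (1 + (#|A u|%:R - 1)^-1) * (#|A u|%:R - 1) <= _).
  by rewrite mulrDl mul1r mulVf ?gt_eqF; lra.
by rewrite ler_pM2r //; lra.
Qed.

(** After exchanging sums, each color of a good [u] blocks at most one [x], so [u] contributes at
    most [a / (a - 1) <= 9/8] with [a = #|A u| >= 9]. *)
Lemma sum_blocking_le : \sum_(x in L) \sum_(u in N :\: bad) k x u <= 9 / 8 * #|N|%:R.
Proof.
rewrite exchange_big /=.
apply: le_trans (_ : \sum_(u in N) (9 / 8 : R) <= _); last first.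
  by rewrite sumr_const mulr_natr.
rewrite [leRHS](big_setID bad) /= addrC.
apply: le_trans (_ : \sum_(u in N :\: bad) (9 / 8 : R) <= _); last first.
  by rewrite lerDl sumr_ge0 // => i _; lra.
apply: ler_sum => u; rewrite in_setD => /andP[ub uN].
move: ub; rewrite inE uN /= -ltnNge => A9.
have A9R : 9 <= #|A u|%:R :> R by rewrite ler_nat.
rewrite -mulr_suml -natr_sum ler_pdivrMr; last by lra.
rewrite -(sum_card_exchange (mem (A u)) (mem L) (fun y x => b u y x)).
apply: le_trans (_ : #|A u|%:R <= _); last by lra.
rewrite ler_nat -sum1_card; apply: leq_sum => y _.
by apply/card_le1_eqP => x x'; rewrite !inE => /andP[_ h] /andP[_ h']; apply: b_injr uN h' h.
Qed.

Lemma sum_unblocked_ge (m : R) : 0 <= m ->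
  expR (- m) * ((#|L|%:R - #|bad|%:R) * (1 + m) - 9 / 8 * #|N|%:R) * #|family A|%:R
  <= (\sum_(h in family A) #|[set x in L | unblocked N h x]|)%:R.
Proof.
move=> m0; rewrite sum_card_exchange natr_sum.
pose K x : R := \sum_(u in N :\: bad) k x u.
pose p x : R := #|[set h in family A | unblocked bad h x]|%:R.
have bN : bad \subset N by apply/subsetP => u; rewrite inE => /andP[].
have K0 x : 0 <= K x.
  apply: sumr_ge0 => u; rewrite in_setD => /andP[ub uN].
  move: ub; rewrite inE uN /= -ltnNge => A9.
  by rewrite divr_ge0 // subr_ge0 ler1n; apply: leq_trans A9.
have pF x : p x <= #|family A|%:R.
  rewrite ler_nat; apply: subset_leq_card; apply/subsetP => h.
  by rewrite inE => /andP[].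
(* As [K x >= 0], the bound [p x <= #|family A|] is spent on the [K x] term only; the [1 + m] term
   keeps [p x]. *)
apply: le_trans (_ : \sum_(x in L)
    expR (- m) * ((1 + m) * p x - K x * #|family A|%:R) <= _); last first.
  apply: ler_sum => x _; apply: le_trans (unblocked_good_ge x).
  apply: le_trans (_ : expR (- m) * (1 + m - K x) * p x <= _).
    rewrite -mulrA ler_pM2l ?expR_gt0 // [leRHS]mulrBl lerD2l lerN2.
    exact: ler_wpM2l.
  by apply: ler_wpM2r => //; apply: expR_tangent.
rewrite -mulr_sumr -mulrA ler_pM2l ?expR_gt0 // sumrB -mulr_sumr -mulr_suml.
rewrite mulrBl lerB //; last by apply: ler_wpM2r => //; apply: sum_blocking_le.
rewrite mulrAC mulrC ler_wpM2l //; first by lra.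
rewrite /p -natr_sum -sum_card_exchange mulrBl lerBlDr -!natrM -natrD ler_nat.
rewrite [(#|L| * _)%N]mulnC [(#|bad| * _)%N]mulnC -!sum_nat_const -big_split /=.
by apply: leq_sum => h _; apply: card_blocked_colors.
Qed.
End LocalCount.

(** * Colorings of induced subgraphs and their extensions *)

Section Colorings.
Variables (V C : finType) (L : V -> {set C}) (conf : V -> C -> V -> C -> bool).
Variable x0 : C.

(* Colors outside [S] are fixed to the junk value [x0], so that the cardinal of
   [cols S] is the number of colorings of the subgraph induced by [S]. *)
Definition cols (S : {set V}) : {set {ffun V -> C}} :=
  [set f : {ffun V -> C} | [forall u, if u \in S then f u \in L u else f u == x0] &&
           [forall u in S, [forall w in S, ~~ conf u (f u) w (f w)]]].

Definition avail (S : {set V}) (f : {ffun V -> C}) (u : V) : {set C} :=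
  [set x in L u | [forall w in S, ~~ conf u x w (f w)]].

(** Singletons outside [N] make the extensions of [g] to an independent set [N] a full product of
    lists. *)
Definition extensions (W N : {set V}) (g : {ffun V -> C}) (u : V) : {set C} :=
  if u \in N then avail W g u else [set g u].

Lemma colsP (S : {set V}) (f : {ffun V -> C}) :
  reflect [/\ {in S, forall u, f u \in L u}, {in ~: S, forall u, f u = x0} &
              {in S &, forall u w, ~~ conf u (f u) w (f w)}] (f \in cols S).
Proof.
rewrite inE; apply: (iffP andP) => [[/forallP fL /forall_inP fc]|[fL f0 fc]].
  split=> [u uS|u|u w uS wS]; first by have := fL u; rewrite uS.
    by rewrite inE => /negPf uS; have := fL u; rewrite uS => /eqP.
  by have /forall_inP := fc u uS; apply.
split; last by apply/forall_inP => u uS; apply/forall_inP => w wS; apply: fc.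
apply/forallP => u; case: ifPn => uS; first exact: fL.
by rewrite f0 // inE.
Qed.

Lemma eq_avail (S S' : {set V}) (f g : {ffun V -> C}) (u : V) :
    {in S :&: S', f =1 g} ->
    (forall x y w, w \in S :\: S' -> ~~ conf u x w y) ->
    (forall x y w, w \in S' :\: S -> ~~ conf u x w y) ->
  avail S f u = avail S' g u.
Proof.
move=> fg nS nS'; apply/setP => x; rewrite !inE; congr (_ && _).
apply/forall_inP/forall_inP => H w wS.
  have [wS'|wS'] := boolP (w \in S); last by apply: nS'; rewrite inE wS wS'.
  by rewrite -fg ?H // inE wS'.
have [wS'|wS'] := boolP (w \in S'); last by apply: nS; rewrite inE wS wS'.
by rewrite fg ?H // inE wS.
Qed.

Lemma family_extensions_eq (W N : {set V}) (g h : {ffun V -> C}) :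
  [disjoint W & N] -> h \in family (extensions W N g) -> {in W, h =1 g}.
Proof.
move=> dWN /familyP hF u uW; have := hF u.
by rewrite /extensions (disjointFr dWN uW) inE => /eqP.
Qed.

Hypothesis conf_sym : forall u x w y, conf u x w y = conf w y u x.
Hypothesis conf_irr : forall u x y, ~~ conf u x u y.

(** Colorings are grouped by their restriction to [W]; without conflicts inside [N], the vertices of
    [N] then choose independently. *)
Lemma big_colsU (T : Type) (idx : T) (op : Monoid.com_law idx)
    (F : {ffun V -> C} -> T) (W N : {set V}) :
    [disjoint W & N] -> {in N &, forall u w x y, ~~ conf u x w y} ->
  \big[op/idx]_(c in cols (W :|: N)) F c =
  \big[op/idx]_(g in cols W) \big[op/idx]_(h in family (extensions W N g)) F h.
Proof.
move=> dWN indN; pose res (f : {ffun V -> C}) := [ffun u => if u \in W then f u else x0].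
rewrite (partition_big res (mem (cols W))) /=; last first.
  move=> c /colsP[cL c0 cc]; apply/colsP; split=> [u uW|u|u w uW wW].
  - by rewrite ffunE uW cL // inE uW.
  - by rewrite inE ffunE => /negPf->.
  - by rewrite !ffunE uW wW cc // inE ?uW ?wW.
apply: eq_bigr => g gW; apply: eq_bigl => c.
have /colsP[gL g0 gc] := gW.
apply/andP/idP => [[/colsP[cL c0 cc] /eqP <-]|cF].
  apply/familyP => u; rewrite /extensions; case: ifPn => uN.
    rewrite inE cL /=; last by rewrite inE uN orbT.
    by apply/forall_inP => w wW; rewrite ffunE wW cc // inE ?uN ?wW ?orbT.
  rewrite inE ffunE; case: ifPn => // uW.
  by rewrite c0 // !inE negb_or uW.
have cg := family_extensions_eq dWN cF; move/familyP: cF => cF.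
have cN u : u \in N -> c u \in avail W g u.
  by move=> uN; have := cF u; rewrite /extensions uN.
have cNW u w : u \in N -> w \in W -> ~~ conf u (c u) w (c w).
  by move=> /cN; rewrite inE => /andP[_ /forall_inP H] wW; rewrite (cg w) // H.
split; last first.
  apply/eqP/ffunP => u; rewrite ffunE; case: ifPn => uW; first exact: cg.
  by rewrite g0 // inE.
apply/colsP; split=> [u|u|u w].
- rewrite inE => /orP[uW|/cN]; first by rewrite cg // gL.
  by rewrite inE => /andP[].
- rewrite !inE negb_or => /andP[uW uN]; have := cF u.
  by rewrite /extensions (negPf uN) inE => /eqP ->; rewrite g0 // inE.
- rewrite !inE => /orP[uW|uN] /orP[wW|wN].
  + by rewrite !cg // gc.
  + by rewrite conf_sym cNW.
  + exact: cNW.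
  + exact: indN.
Qed.

Lemma card_extensions1 (S : {set V}) (v : V) (g : {ffun V -> C}) :
  #|family (extensions S [set v] g)| = #|avail S g v|.
Proof.
rewrite card_family_prod (bigD1 v) //= big1 ?muln1.
  by rewrite /extensions set11.
by move=> u uv; rewrite /extensions inE (negPf uv) cards1.
Qed.

Lemma card_colsU1 (S : {set V}) (v : V) : v \notin S ->
  #|cols (v |: S)| = (\sum_(f in cols S) #|avail S f v|)%N.
Proof.
move=> vS; rewrite setUC -sum1_card big_colsU; first last.
- by move=> u w /set1P-> /set1P-> x y; apply: conf_irr.
- by rewrite disjoint_sym disjoints1.
by apply: eq_bigr => g _; rewrite sum1_card card_extensions1.
Qed.

(** The list at [u] is determined by the coloring of [S :\ u], which extends to [u] in as many ways
    as that list has colors. *)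
Lemma card_low_avail (S : {set V}) (u : V) (t : nat) : u \in S ->
  (#|[set c in cols S | (#|avail (S :\ u) c u| <= t)%N]| <= t * #|cols (S :\ u)|)%N.
Proof.
move=> uS; have dS : [disjoint S :\ u & [set u]].
  by rewrite disjoint_sym disjoints1 !inE eqxx.
rewrite -sum1dep_card big_mkcondr -{1}(setD1K uS) setUC big_colsU //=; last first.
  by move=> u' w /set1P-> /set1P-> x y; apply: conf_irr.
rewrite mulnC -sum_nat_const; apply: leq_sum => g gS.
rewrite (eq_bigr (fun=> nat_of_bool (#|avail (S :\ u) g u| <= t)%N)); last first.
  move=> h /(family_extensions_eq dS) hg.
  rewrite (@eq_avail _ (S :\ u) h g) ?setIid //.
    by move=> x y w; rewrite setDv inE.
  by move=> x y w; rewrite setDv inE.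
rewrite sum_nat_const card_extensions1.
by case: (leqP #|avail (S :\ u) g u| t) => H /=; rewrite ?muln0 ?muln1.
Qed.

End Colorings.

(** * Growth of the number of colorings when a vertex is added *)

Section CountingStep.
Variables (R : realType) (V C : finType) (E : rel V) (L : V -> {set C}).
Variables (conf : V -> C -> V -> C -> bool) (x0 : C).
Hypothesis E_irr : irreflexive E.
Hypothesis E_free : triangle_free E.
Hypothesis confE : forall u x w y, conf u x w y -> E u w.
Hypothesis conf_sym : forall u x w y, conf u x w y = conf w y u x.
Hypothesis conf_inj : forall u x w y y', conf u x w y -> conf u x w y' -> y = y'.

Let cols := cols L conf x0.

Lemma card_cols_ge (S : {set V}) (v : V) (l m : R) : v \notin S -> 0 < l -> 0 <= m ->
    let N := [set u in S | E v u] in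
    {in N, forall u, l * #|cols (S :\ u)|%:R <= #|cols S|%:R} ->
  expR (- m) * ((#|L v|%:R - 8 * #|N|%:R / l) * (1 + m) - 9 / 8 * #|N|%:R)
    * #|cols S|%:R <= #|cols (v |: S)|%:R.
Proof.
move=> vS l0 m0 N IH.
have conf_irr u x y : ~~ conf u x u y.
  by apply/negP => /confE; rewrite E_irr.
have indN : {in N &, forall u w x y, ~~ conf u x w y}.
  move=> u w; rewrite !inE => /andP[_ vu] /andP[_ vw] x y; apply/negP => /confE uw.
  by have := E_free v u w; rewrite vu uw vw.
pose W := S :\: N.
have NS : N \subset S by apply/subsetP => u; rewrite inE => /andP[].
have SE : S = W :|: N.
  by apply/setP => u; rewrite !inE; case: (u \in S); case: (E v u).
have dWN : [disjoint W & N].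
  by rewrite -setI_eq0; apply/eqP/setP => u; rewrite !inE; case: (u \in S); case: (E v u).
pose bad c := [set u in N | (#|avail L conf (S :\ u) c u| <= 8)%N].
(* Colors on the independent set [N] do not affect lists at vertices of [N], so badness depends on
   [g] alone. *)
have badE g h : h \in family (extensions L conf W N g) ->
    [set u in N | (#|extensions L conf W N g u| <= 8)%N] = bad h.
  move=> hF; apply/setP => u; rewrite /bad [LHS]in_set [RHS]in_set.
  case uN: (u \in N) => //=.
  suff -> : extensions L conf W N g u = avail L conf (S :\ u) h u by [].
  rewrite /extensions uN; apply: eq_avail => [w /setIP[wW _]|x y w|x y w].
  - by rewrite (family_extensions_eq dWN hF).
  - rewrite !inE => /andP[+ /andP[_ wS]]; rewrite wS andbT negbK => /eqP ->.
    exact: conf_irr.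
  - rewrite !inE => /andP[H /andP[_ wS]]; apply: indN => //.
    by move: H; rewrite wS andbT negbK inE wS.
have split (F : {ffun V -> C} -> R) : \sum_(c in cols S) F c =
    \sum_(g in cols W) \sum_(h in family (extensions L conf W N g)) F h.
  by rewrite {1}SE big_colsU.
pose Q c : R := (#|L v|%:R - #|bad c|%:R) * (1 + m) - 9 / 8 * #|N|%:R.
apply: le_trans (_ : \sum_(c in cols S) expR (- m) * Q c <= _); last first.
  rewrite card_colsU1 // natr_sum !split.
  apply: ler_sum => g gW; rewrite -natr_sum.
  pose b u y x := conf v x u y.
  have := @sum_unblocked_ge R V C b N (L v) (extensions L conf W N g) _ _ m m0.
  rewrite (eq_bigr (fun h => #|avail L conf S h v|)); last first.
    move=> h _; apply: eq_card => x; rewrite !inE; congr (_ && _).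
    apply/forall_inP/forall_inP => H w wS; last by apply: H; apply: (subsetP NS).
    have [vw|vw] := boolP (E v w); first by apply: H; rewrite inE wS.
    by apply: contra vw => /confE.
  move=> H; apply: le_trans (H _ _).
  - pose bad_g := [set u in N | (#|extensions L conf W N g u| <= 8)%N].
    rewrite (eq_bigr (fun=> expR (- m) *
        ((#|L v|%:R - #|bad_g|%:R) * (1 + m) - 9 / 8 * #|N|%:R))).
      by rewrite sumr_const -[leLHS]mulr_natr.
    by move=> h hF; rewrite /Q -(badE _ _ hF).
  - by move=> u y y' x _; apply: conf_inj.
  - by move=> u y x x' _; rewrite /b conf_sym [in X in _ -> X -> _]conf_sym; apply: conf_inj.
rewrite -mulr_sumr -mulrA ler_pM2l ?expR_gt0 // /Q sumrB -mulr_suml sumrB.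
have sumc (a : R) : \sum_(c in cols S) a = a * #|cols S|%:R.
  by rewrite sumr_const [RHS]mulr_natr.
rewrite !sumc mulrBl lerB // mulrAC.
rewrite ler_wpM2r //; first by lra.
rewrite mulrBl lerB // -natr_sum.
(* The average number of bad neighbors is counted one neighbor at a time, to apply [card_low_avail]
   and then [IH]. *)
have -> : (\sum_(c in cols S) #|bad c| =
           \sum_(u in N) #|[set c in cols S | (#|avail L conf (S :\ u) c u| <= 8)%N]|)%N.
  exact: sum_card_exchange.
rewrite mulrAC ler_pdivlMr // mulrC natr_sum mulr_sumr.
apply: le_trans (_ : \sum_(u in N) 8 * #|cols S|%:R <= _); last first.
  by rewrite sumr_const -[leLHS]mulr_natr mulrAC.
apply: ler_sum => u uN.
apply: le_trans (_ : l * (8 * #|cols (S :\ u)|%:R) <= _).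
  rewrite ler_pM2l // -natrM ler_nat; apply: card_low_avail => //.
  exact: (subsetP NS).
by rewrite mulrCA ler_pM2l // IH.
Qed.

Lemma card_cols_induction (l : R) (m : V -> R) : 0 < l ->
    (forall v, 0 <= m v) ->
    (forall v, l <= expR (- m v) *
       ((#|L v|%:R - 8 * (degree E v)%:R / l) * (1 + m v) - 9 / 8 * (degree E v)%:R)) ->
  forall (S : {set V}) v, v \notin S -> l * #|cols S|%:R <= #|cols (v |: S)|%:R.
Proof.
move=> l0 m0 lm S; have [n] := ubnP #|S|; elim: n S => // n IHn S Sn v vS.
have Nd : (#|[set u in S | E v u]| <= degree E v)%N.
  by apply: subset_leq_card; apply/subsetP => u; rewrite !inE => /andP[].
apply: le_trans (card_cols_ge vS l0 (m0 v) _); last first.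
  move=> u; rewrite inE => /andP[uS _].
  have := IHn (S :\ u) _ u; rewrite setD1K //; apply.
    by move: Sn; rewrite (cardsD1 u S) uS.
  by rewrite !inE eqxx.
rewrite ler_wpM2r //; apply: le_trans (lm v) _.
(* The lower bound decreases with the number of neighbors, so the neighbors in [S] may be replaced
   by the full degree. *)
have NdR : #|[set u in S | E v u]|%:R <= (degree E v)%:R :> R by rewrite ler_nat.
rewrite ler_pM2l ?expR_gt0 // lerB //; last by rewrite ler_pM2l //; lra.
rewrite ler_wpM2r //; first by have := m0 v; lra.
by rewrite lerB // ler_pM2r ?invr_gt0 // ler_pM2l.
Qed.

End CountingStep.

(** * Choice of the threshold and conclusion *)

Theorem theorem1p12 (R : realType) (xi : R) (xi_gt0 : 0 < xi) :
  exists Delta0 : nat, forall Delta : nat, (Delta0 <= Delta)%N ->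
  forall (V : finType) (E : rel V) (C : finType)
         (L : V -> {set C}) (M : {set V} -> {set {set V * C}}),
    simple_graph E ->
    triangle_free E ->
    (max_degree E <= Delta)%N ->
    correspondence_assignment E L M ->
    (forall v : V,
        (4%:R + xi) * ((degree E v)%:R / log2 ((degree E v)%:R : R))
          <= #|L v|%:R
        /\ ln (Delta%:R : R) ^+ 2 <= (degree E v)%:R) ->
    LM_colorable E L M.
Proof.
pose D0 : R := expR (20 * 1000).
exists (Num.bound (expR D0)) => Delta Delta_ge V E C L M [E_sym E_irr] E_free.
move=> max_deg corr lists.
have Delta_gt : expR D0 < Delta%:R.
  by apply: lt_le_trans (archi_boundP (expR_ge0 _)) _; rewrite ler_nat.
have Delta_pos : 0 < Delta%:R :> R by apply: lt_trans Delta_gt; apply: expR_gt0.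
set D : R := ln Delta%:R in lists.
have DD0 : D0 <= D by rewrite /D -[leLHS]expRK ler_ln ?posrE ?expR_gt0 // ltW.
have D_gt0 : 0 < D by apply: lt_le_trans DD0; apply: expR_gt0.
have D_gt1 : 1 < D.
  by apply: lt_le_trans DD0; rewrite /D0 -[ltLHS]expR0 ltr_expR; lra.
have deg_gt1 v : 1 < (degree E v)%:R :> R.
  by have [_] := lists v; apply: lt_le_trans; rewrite exprn_egt1.
have deg_le v : ln (degree E v)%:R <= D :> R.
  rewrite ler_ln ?posrE //; last by apply: lt_trans (deg_gt1 v).
  rewrite ler_nat; apply: leq_trans max_deg.
  exact: (leq_bigmax v).
have L_ge v : 8 / 3 * ((degree E v)%:R / ln (degree E v)%:R) <= #|L v|%:R :> R.
  have [Lv _] := lists v; apply: le_trans Lv.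
  have -> (d : R) : d / log2 d = ln 2 * (d / ln d) by rewrite /log2 invf_div mulrCA.
  rewrite [leRHS]mulrA ler_wpM2r //; first by rewrite divr_ge0 ?ln_ge0 // ltW.
  (* The constant [8/3] is [4 * (2/3)], with [2/3] a lower bound for [ln 2]. *)
  apply: le_trans (_ : (4 + xi) * (2 / 3) <= _); first by lra.
  by rewrite ler_wpM2l ?ln2_ge //; lra.
pose m v : R := 9 / 20 * ln (degree E v)%:R.
have m_ge0 v : 0 <= m v by rewrite mulr_ge0 ?ln_ge0 ?ltW //; lra.
have bound v : 48 * D <= expR (- m v) * ((#|L v|%:R - 8 * (degree E v)%:R / (48 * D))
    * (1 + m v) - 9 / 8 * (degree E v)%:R).
  by apply: tangent_bound_ge => //; have [] := lists v.
(* The junk color [x0] comes from a nonempty list; with no vertices [C] may be empty, but the empty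
   map is a coloring. *)
have [v0 _|V0] := pickP (mem V); last first.
  have noV (v : V) : False by have := V0 v.
  by exists (fun v => False_rect C (noV v)); split => u; have := V0 u.
have /card_gt0P[x0 _] : (0 < #|L v0|)%N.
  rewrite -(ltr0n R); apply: lt_le_trans (L_ge v0).
  have d1 := deg_gt1 v0.
  rewrite mulr_gt0 ?divr_gt0 ?ln_gt0 //; last by apply: lt_trans d1.
pose conf u x w y := E u w && ([set (u, x); (w, y)] \in M [set u; w]).
have conf_sym u x w y : conf u x w y = conf w y u x.
  by rewrite /conf E_sym setUC [in X in M X]setUC.
have conf_inj u x w y y' : conf u x w y -> conf u x w y' -> y = y'.
  move=> /andP[uw f] /andP[_ g]; have [_ disj] := corr u w uw.
  (* Equal matching edges force [y = y'] as [u] and [w] differ; distinct ones would share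
     [(u, x)]. *)
  have [fg|fg] := eqVneq [set (u, x); (w, y)] [set (u, x); (w, y')].
    have : (w, y) \in [set (u, x); (w, y')] by rewrite -fg !inE eqxx orbT.
    rewrite !inE => /orP[/eqP[wu _]|/eqP[]//].
    by move: uw; rewrite wu E_irr.
  have /disjointFr := disj _ _ f g fg => /(_ (u, x)).
  by rewrite !inE eqxx => /(_ isT).
have confE u x w y : conf u x w y -> E u w by case/andP.
have l_gt0 : 0 < 48 * D by lra.
have step :=
  card_cols_induction x0 E_irr E_free confE conf_sym conf_inj l_gt0 m_ge0 bound.
have cols_gt0 (S : {set V}) : (0 < #|cols L conf x0 S|)%N.
  have [n] := ubnP #|S|; elim: n S => // n IHn S Sn.
  have [->|[v vS]] := set_0Vmem S.
    apply/card_gt0P; exists [ffun=> x0]; apply/colsP; split=> [u|u _|u w];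
      by rewrite ?inE ?ffunE.
  have : (0 < #|cols L conf x0 (S :\ v)|)%N.
    by apply: IHn; move: Sn; rewrite (cardsD1 v S) vS.
  rewrite -!(ltr0n R) => pos; have := step (S :\ v) v; rewrite setD1K //.
  by rewrite !inE eqxx => /(_ isT); apply: lt_le_trans; rewrite mulr_gt0.
have /card_gt0P[f /colsP[fL _ fc]] := cols_gt0 [set: V].
exists f; split=> [u|u w uw]; first by apply: fL.
by have := fc u w; rewrite !inE => /(_ isT isT); rewrite /conf uw.
Qed.
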